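(* Let $t\in\{0,\dots,T-1\}$, let $S\subseteq B_t$, and let the fixed-state Adam local utility be $$U_{\mathrm{Adam}}^{(t)}(S;z^{(\mathrm{val})})=\ell(\widetilde w_{t+1}(S),z^{(\mathrm{val})})-\ell(w_t,z^{(\mathrm{val})}),\qquad \widetilde w_{t+1}(S)=w_t-\eta_t\frac{m_t(S)}{\sqrt{v_t(S)}+\epsilon}.$$ Then the first-order approximation of $U_{\mathrm{Adam}}^{(t)}(S;z^{(\mathrm{val})})$, i.e. the expression obtained by replacing $w\mapsto\ell(w,z^{(\mathrm{val})})$ with its first-order Taylor polynomial at $w_t$, equals $$-\eta_t\Big\langle \nabla\ell(w_t,z^{(\mathrm{val})}),\ \frac{m_t(S)}{\sqrt{v_t(S)}+\epsilon}\Big\rangle .$$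
   Context: $\ell(w,z)$ is a real-valued loss, differentiable in $w\in\mathbb{R}^d$, with gradient $\nabla\ell(w,z)$ in $w$; $z^{(\mathrm{val})}$ is a validation point; $B_t$ is the finite mini-batch of training points at iteration $t$; $w_t\in\mathbb{R}^d$ is the current parameter and $\eta_t\in\mathbb{R}$ the learning rate. The Adam hyperparameters satisfy $\beta_1,\beta_2\in[0,1)$, $\epsilon>0$, and the previous moments $m_{t-1}\in\mathbb{R}^d$, $v_{t-1}\in[0,\infty)^d$ are held fixed (independent of $S$). For $S\subseteq B_t$ the coalition gradient is $g_t(S)=\sum_{z\in S}\nabla\ell(w_t,z)$, and $$m_t(S)=\beta_1 m_{t-1}+(1-\beta_1)g_t(S),\qquad v_t(S)=\beta_2 v_{t-1}+(1-\beta_2)g_t(S)^{\odot 2}.$$ Squares $(\cdot)^{\odot 2}$, square roots, divisions and addition of the scalar $\epsilon$ are coordinatewise; $\langle\cdot,\cdot\rangle$ is the Euclidean inner product. *)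

(* Defs.v *)
From HB Require Import structures.
From mathcomp Require Import all_boot all_order all_algebra finmap.
From mathcomp Require Import all_classical all_reals all_analysis.

Set Implicit Arguments.
Unset Strict Implicit.
Unset Printing Implicit Defensive.

Import Order.TTheory GRing.Theory Num.Theory.
Import numFieldNormedType.Exports.

Local Open Scope ring_scope.

Definition dotp (R : realType) (d : nat) (u v : 'rV[R]_d) : R :=
  \sum_(i < d) u 0 i * v 0 i.

Definition grad (R : realType) (d : nat) (f : 'rV[R]_d -> R) (a : 'rV[R]_d) :
    'rV[R]_d :=
  \row_(i < d) 'D_(delta_mx 0 i) f a.

(* ['d f a] is the Frechet differential; it is meaningful only where [f] is
   differentiable. *)
Definition taylor1 (R : realType) (d : nat) (f : 'rV[R]_d -> R)
    (a x : 'rV[R]_d) : R :=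
  f a + 'd f a (x - a).

(* A quantity [Phi f] computed from a function [f] is linearized at [a] by
   substituting for [f], at each of its occurrences in [Phi], its first-order
   Taylor polynomial at [a]. *)
Definition first_order_approx (R : realType) (d : nat)
    (Phi : ('rV[R]_d -> R) -> R) (f : 'rV[R]_d -> R) (a : 'rV[R]_d) : R :=
  Phi (taylor1 f a).

Definition coalition_grad (R : realType) (d : nat) (Z : choiceType)
    (l : 'rV[R]_d -> Z -> R) (w : 'rV[R]_d) (S : {fset Z}) : 'rV[R]_d :=
  \sum_(z <- S) grad (fun u => l u z) w.

Definition adam_m (R : realType) (d : nat) (beta1 : R) (mprev g : 'rV[R]_d) :
    'rV[R]_d :=
  beta1 *: mprev + (1 - beta1) *: g.

Definition adam_v (R : realType) (d : nat) (beta2 : R) (vprev g : 'rV[R]_d) :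
    'rV[R]_d :=
  beta2 *: vprev + (1 - beta2) *: map_mx (fun x : R => x ^+ 2) g.

Definition adam_ratio (R : realType) (d : nat) (eps : R) (m v : 'rV[R]_d) :
    'rV[R]_d :=
  map2_mx (fun x y : R => x / y) m (map_mx Num.sqrt v + const_mx eps).

Definition adam_direction (R : realType) (d : nat) (Z : choiceType)
    (l : 'rV[R]_d -> Z -> R) (beta1 beta2 eps : R) (mprev vprev w : 'rV[R]_d)
    (S : {fset Z}) : 'rV[R]_d :=
  let g := coalition_grad l w S in
  adam_ratio eps (adam_m beta1 mprev g) (adam_v beta2 vprev g).

Definition adam_next (R : realType) (d : nat) (Z : choiceType)
    (l : 'rV[R]_d -> Z -> R) (beta1 beta2 eps : R) (mprev vprev w : 'rV[R]_d)
    (eta : R) (S : {fset Z}) : 'rV[R]_d :=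
  w - eta *: adam_direction l beta1 beta2 eps mprev vprev w S.

(* The utility as a functional of the validation loss [phi], which is
   [fun u => l u zval] for the validation point [zval]; the training gradients
   inside [adam_next] do not depend on [phi]. *)
Definition adam_utility (R : realType) (d : nat) (Z : choiceType)
    (l : 'rV[R]_d -> Z -> R) (beta1 beta2 eps : R) (mprev vprev w : 'rV[R]_d)
    (eta : R) (S : {fset Z}) (phi : 'rV[R]_d -> R) : R :=
  phi (adam_next l beta1 beta2 eps mprev vprev w eta S) - phi w.

(* Main.v *)
Require Import Defs.
From HB Require Import structures.
From mathcomp Require Import all_boot all_order all_algebra finmap.
From mathcomp Require Import all_classical all_reals all_analysis.

Set Implicit Arguments.
Unset Strict Implicit.
Unset Printing Implicit Defensive.

Import Order.TTheory GRing.Theory Num.Theory.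
Import numFieldNormedType.Exports.

Local Open Scope ring_scope.

(** The Adam step is computed from training gradients that the linearization leaves untouched, so it
    acts as a fixed displacement. The constant terms of the Taylor polynomial cancel in the utility,
    leaving the differential at this displacement; linearity pulls out [- eta t], and [diff_grad]
    gives the inner product. *)

(** Expand [v] in the standard basis: by [deriveE], differentiability makes the differential on
    basis vectors agree with the partial derivatives in [grad]. *)
Lemma diff_grad (R : realType) (d : nat) (f : 'rV[R]_d -> R) (a v : 'rV[R]_d) :
  differentiable f a -> 'd f a v = dotp (grad f a) v.
Proof.
move=> df; rewrite {1}[v]row_sum_delta linear_sum /dotp.
by apply: eq_bigr => i _; rewrite linearZ /= mxE deriveE // mulrC.
Qed.

Theorem lemma4p1 (R : realType) (d : nat) (Z : choiceType)
    (l : 'rV[R]_d -> Z -> R)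
    (hl : forall (z : Z) (u : 'rV[R]_d), differentiable (fun x => l x z) u)
    (T : nat) (w : nat -> 'rV[R]_d) (eta : nat -> R) (B : nat -> {fset Z})
    (beta1 beta2 eps : R)
    (hbeta1 : 0 <= beta1 < 1) (hbeta2 : 0 <= beta2 < 1) (heps : 0 < eps)
    (mprev vprev : nat -> 'rV[R]_d)
    (hv : forall (s : nat) (i : 'I_d), 0 <= vprev s 0 i)
    (zval : Z) (t : nat) (ht : (t < T)%N)
    (S : {fset Z}) (hS : (S `<=` B t)%fset) :
  first_order_approx
    (adam_utility l beta1 beta2 eps (mprev t) (vprev t) (w t) (eta t) S)
    (fun u => l u zval) (w t)
  = - eta t * dotp (grad (fun u => l u zval) (w t))
      (adam_direction l beta1 beta2 eps (mprev t) (vprev t) (w t) S).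
Proof.
(* The subtracted loss is linearized too, but at the base point its linear term is the differential
   at [0]. *)
rewrite /first_order_approx /adam_utility /taylor1 subrr linear0 addr0.
(* The first [addKr] cancels the loss at [w t], the second cancels [w t] itself inside the
   differential. *)
by rewrite addrC addKr /adam_next addrC addKr -scaleNr linearZ /= diff_grad.
Qed.
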